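(* For every exotic quintuple $(a,b,c,d,e)$ there is a rational point $(r,t,y)\in S(\mathbb{Q})$ on the affine surface $S$ such that $(a,b,c,d,e)=p(r,t,y)$. Conversely, if $(r,t,y)\in S(\mathbb{Q})$ is a rational point in the domain of $p$, then $p(r,t,y)=(a,b,c,d,e)$ is an exotic quintuple provided that all its elements $a,b,c,d,e$ are distinct and nonzero.
   Context: A rational Diophantine $m$-tuple is a set of $m$ distinct nonzero rational numbers such that the product of any two distinct elements plus $1$ is a square in $\mathbb{Q}$. A Diophantine quadruple $\{a,b,c,d\}$ is called regular if $(a+b-c-d)^2=4(ab+1)(cd+1)$ (this condition is symmetric in $a,b,c,d$). A rational Diophantine quintuple, written in order as $(a,b,c,d,e)$, is called exotic if $abcd=1$, the quadruples $\{a,b,d,e\}$ and $\{a,c,d,e\}$ are regular, and the product of any two of its (distinct) elements is a square in $\mathbb{Q}$. $S$ is the affine surface over $\mathbb{Q}$ with coordinates $(r,t,y)$ defined by $$(1 + r - 2 r^2 t - t^2 + r t^2)(-1 + r + 2 r^2 t + t^2 + r t^2)(-r - r^2 - 2t - r t^2 + r^2 t^2)(r - r^2 - 2 t + r t^2 + r^2 t^2)=y^2.$$ The rational map $p:S\rightarrow\mathbb{A}^5$ is given by $p(r,t,y)=(a,b,c,d,e)$, where one sets $$s=\frac{-1 + r^2 + t + r^2 t}{-1 - r^2 - t + r^2 t}$$ and $$a=\frac{(r^2-1)(t^2-1)(s^2-1)}{8rst},\quad b=\frac{2(t^2-1)rs}{(r^2-1)(s^2-1)t},\quad c=\frac{2(s^2-1)rt}{(r^2-1)(t^2-1)s},\quad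 d=\frac{2(r^2-1)st}{(s^2-1)(t^2-1)r},$$ $$e=\frac{u_1u_2u_3u_4}{8(-1+r)r(1+r)(-1+s)s(1+s)(-1+t)t(1+t)},$$ with $$u_1=-1 - r + s - r s - t - r t - s t + r s t,\qquad u_2=1 + r - s + r s - t - r t - s t + r s t,$$ $$u_3=1 - r - s - r s + t - r t + s t + r s t,\qquad u_4=-1 + r + s + r s + t - r t + s t + r s t.$$ The domain of $p$ is the set of points of $S$ where these formulas are defined (all denominators nonzero). *)

(* Defs.v *)
From mathcomp Require Import all_boot all_order all_algebra.

Set Implicit Arguments.
Unset Strict Implicit.
Unset Printing Implicit Defensive.

Import GRing.Theory Num.Theory.

Local Open Scope ring_scope.

Definition is_square (x : rat) : Prop := exists q : rat, x = q ^+ 2.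

(* A rational Diophantine m-tuple is such an l with size l = m. *)
Definition diophantine_tuple (l : seq rat) : Prop :=
  [/\ uniq l,
      0 \notin l
    & {in l &, forall x y, x != y -> is_square (x * y + 1)}].

(* Regularity of a Diophantine quadruple; being Diophantine is assumed
   separately wherever this is used. *)
Definition regular (a b c d : rat) : Prop :=
  (a + b - c - d) ^+ 2 = 4 * (a * b + 1) * (c * d + 1).

Definition exotic (a b c d e : rat) : Prop :=
  [/\ diophantine_tuple [:: a; b; c; d; e],
      a * b * c * d = 1,
      regular a b d e,
      regular a c d e
    & {in [:: a; b; c; d; e] &, forall x y, x != y -> is_square (x * y)}].

(* The rational points S(Q). *)
Definition on_S (r t y : rat) : Prop :=
  (1 + r - 2 * r ^+ 2 * t - t ^+ 2 + r * t ^+ 2)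
  * (- 1 + r + 2 * r ^+ 2 * t + t ^+ 2 + r * t ^+ 2)
  * (- r - r ^+ 2 - 2 * t - r * t ^+ 2 + r ^+ 2 * t ^+ 2)
  * (r - r ^+ 2 - 2 * t + r * t ^+ 2 + r ^+ 2 * t ^+ 2)
  = y ^+ 2.

Definition s_num (r t : rat) : rat := - 1 + r ^+ 2 + t + r ^+ 2 * t.
Definition s_den (r t : rat) : rat := - 1 - r ^+ 2 - t + r ^+ 2 * t.
Definition s_of (r t : rat) : rat := s_num r t / s_den r t.

Definition p_a (r s t : rat) : rat :=
  ((r ^+ 2 - 1) * (t ^+ 2 - 1) * (s ^+ 2 - 1)) / (8 * r * s * t).
Definition p_b (r s t : rat) : rat :=
  (2 * (t ^+ 2 - 1) * r * s) / ((r ^+ 2 - 1) * (s ^+ 2 - 1) * t).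
Definition p_c (r s t : rat) : rat :=
  (2 * (s ^+ 2 - 1) * r * t) / ((r ^+ 2 - 1) * (t ^+ 2 - 1) * s).
Definition p_d (r s t : rat) : rat :=
  (2 * (r ^+ 2 - 1) * s * t) / ((s ^+ 2 - 1) * (t ^+ 2 - 1) * r).

Definition u1 (r s t : rat) : rat :=
  - 1 - r + s - r * s - t - r * t - s * t + r * s * t.
Definition u2 (r s t : rat) : rat :=
  1 + r - s + r * s - t - r * t - s * t + r * s * t.
Definition u3 (r s t : rat) : rat :=
  1 - r - s - r * s + t - r * t + s * t + r * s * t.
Definition u4 (r s t : rat) : rat :=
  - 1 + r + s + r * s + t - r * t + s * t + r * s * t.

Definition p_e (r s t : rat) : rat :=
  (u1 r s t * u2 r s t * u3 r s t * u4 r s t)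
  / (8 * (- 1 + r) * r * (1 + r) * (- 1 + s) * s * (1 + s)
       * (- 1 + t) * t * (1 + t)).

(* Division on rat is total, so p is given as a total function, which is
   meaningful only on dom_p; the coordinate y does not occur in its formulas. *)
Definition p (r t y : rat) : rat * rat * rat * rat * rat :=
  let s := s_of r t in
  (p_a r s t, p_b r s t, p_c r s t, p_d r s t, p_e r s t).

(* The points of S where every denominator is nonzero: that of s, and then
   those of a, b, c, d, e. *)
Definition dom_p (r t y : rat) : Prop :=
  let s := s_of r t in
  [/\ on_S r t y,
      s_den r t != 0,
      [/\ 8 * r * s * t != 0,
          (r ^+ 2 - 1) * (s ^+ 2 - 1) * t != 0,
          (r ^+ 2 - 1) * (t ^+ 2 - 1) * s != 0
        & (s ^+ 2 - 1) * (t ^+ 2 - 1) * r != 0]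
    & 8 * (- 1 + r) * r * (1 + r) * (- 1 + s) * s * (1 + s)
        * (- 1 + t) * t * (1 + t) != 0].

(* Main.v *)
Require Import Defs.
From mathcomp Require Import all_boot all_order all_algebra.
From mathcomp Require Import ring.

(** In an exotic quintuple the numbers [a * b], [a * c], [a * d] and their
    successors are squares, hence points of the rational hyperbola
    [w ^+ 2 = u ^+ 2 + 1], which [x |-> (sh x, ch x)] parametrizes. Choosing
    [t], [s], [r] for the three of them and using [a * b * c * d = 1] gives
    [a = sh r * sh s * sh t], [b = sh t / (sh r * sh s)], and so on: these are the
    formulas of [p].

    Each regularity condition is quadratic in [e] with square discriminant, and
    after a choice of signs [e] is in both the root with the minus sign: the first gives
    [a * e + 1 = (sh r * sh t * ch s - ch r * ch t) ^+ 2], which is the formula for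
    [e] ([regular_iff_extension], [p_eE]), and the second the same with [s] and
    [t] exchanged. The two values agree when
    [(sh t + sh s) * (1 + 2 * sh r ^+ 2) = 2 * sh r * ch r * ch s * ch t], as
    [b != c] ([extension_sqr_diff]). This equation is quadratic in [s], but it
    splits over the rationals into two factors linear in [s]; one of them is the
    formula for [s] in terms of [r] and [t], and the other is equivalent to it
    under [(r, s) |-> (- r^-1, - s^-1)], which keeps [sh r], [sh s] and the
    product [ch r * ch s] ([coupling_factor]).

    It remains to require that products with [e] be squares. Since [a * b],
    [a * c], [a * d] already are, this amounts to [a * e] being a square, and
    after the substitution of [s] this is the equation of the surface, up to
    square factors ([quarticsE]). The products with [e] plus one are then squares
    thanks to regularity ([regular_square]), because [sh r ^+ 2 + 1] and
    [sh t ^+ 2 + 1] are nonzero squares. *)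

Import Order.TTheory GRing.Theory Num.Theory.

Local Open Scope ring_scope.

(** * The rational hyperbola *)

(** The hyperbolic sine and cosine of [log x]: rational functions of [x] that
    parametrize the conic [w ^+ 2 = u ^+ 2 + 1]. *)
Definition sh (x : rat) : rat := (x - x^-1) / 2.
Definition ch (x : rat) : rat := (x + x^-1) / 2.

Lemma mul3_neq0 (x y z : rat) : x != 0 -> y != 0 -> z != 0 -> x * y * z != 0.
Proof. by move=> *; rewrite !mulf_neq0. Qed.

Lemma ch_sqr (x : rat) : x != 0 -> ch x ^+ 2 = sh x ^+ 2 + 1.
Proof. by move=> x0; rewrite /ch /sh; field; rewrite x0. Qed.

Lemma shE (x : rat) : x != 0 -> x ^+ 2 - 1 = 2 * x * sh x.
Proof. by move=> x0; rewrite /sh; field. Qed.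

Lemma chE (x : rat) : x != 0 -> x ^+ 2 + 1 = 2 * x * ch x.
Proof. by move=> x0; rewrite /ch; field. Qed.

Lemma sqr1_neq0 (x : rat) : x ^+ 2 + 1 != 0.
Proof. by rewrite gt_eqF // ltr_wpDl // sqr_ge0. Qed.

Lemma ch_neq0 (x : rat) : x != 0 -> ch x != 0.
Proof.
move=> x0; have := sqr1_neq0 x; rewrite chE //.
by apply: contraNneq => ->; rewrite mulr0.
Qed.

(** The point [(u, w)] comes from [x = u + w], whose inverse is [w - u]. *)
Lemma hyperbola_param (u w : rat) :
  w ^+ 2 = u ^+ 2 + 1 -> exists x, [/\ x != 0, sh x = u & ch x = w].
Proof.
move=> h; have e : (u + w) * (w - u) = 1 by rewrite -[1](addKr (u ^+ 2)) -h; ring.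
have x0 : u + w != 0.
  by apply/eqP => x0; move: e; rewrite x0 mul0r => /esym/eqP; rewrite oner_eq0.
have ei : (u + w)^-1 = w - u by rewrite -[RHS](mulKf x0) e mulr1.
by exists (u + w); split=> //; rewrite /sh /ch ei; field.
Qed.

(** The substitution [x |-> - x^-1] fixes [sh x] and changes the sign of [ch x]:
    it is the freedom left in a parameter once its [sh] is prescribed. *)
Lemma sh_negV (x : rat) : sh (- x^-1) = sh x.
Proof. by rewrite /sh invrN invrK; ring. Qed.

Lemma ch_negV (x : rat) : ch (- x^-1) = - ch x.
Proof. by rewrite /ch invrN invrK; ring. Qed.

(** * The map p and the surface S in hyperbolic coordinates *)

Lemma p_aE (r s t : rat) : r != 0 -> s != 0 -> t != 0 ->
  p_a r s t = sh r * sh s * sh t.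
Proof. by move=> *; rewrite /p_a !shE //; field; apply/and3P. Qed.

Lemma p_bE (r s t : rat) : r != 0 -> s != 0 -> t != 0 ->
  sh r != 0 -> sh s != 0 -> p_b r s t = sh t / (sh r * sh s).
Proof. by move=> *; rewrite /p_b !shE //; field; apply/and5P. Qed.

Lemma p_cE (r s t : rat) : r != 0 -> s != 0 -> t != 0 ->
  sh r != 0 -> sh t != 0 -> p_c r s t = sh s / (sh r * sh t).
Proof. by move=> *; rewrite /p_c !shE //; field; apply/and5P. Qed.

Lemma p_dE (r s t : rat) : r != 0 -> s != 0 -> t != 0 ->
  sh s != 0 -> sh t != 0 -> p_d r s t = sh r / (sh s * sh t).
Proof. by move=> *; rewrite /p_d !shE //; field; apply/and5P. Qed.

(** Up to sign, [u1 * u4] and [u2 * u3] are [8 * r * s * t] times the two factors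
    of the difference of squares on the right. *)
Lemma u_prodE (r s t : rat) : r != 0 -> s != 0 -> t != 0 ->
  u1 r s t * u2 r s t * u3 r s t * u4 r s t =
  (8 * r * s * t) ^+ 2 * ((sh r * sh t * ch s - ch r * ch t) ^+ 2 - 1).
Proof.
by move=> r0 s0 t0; rewrite /u1 /u2 /u3 /u4 /sh /ch; field; rewrite r0 s0 t0.
Qed.

Lemma p_eE (r s t : rat) : r != 0 -> s != 0 -> t != 0 ->
  sh r != 0 -> sh s != 0 -> sh t != 0 ->
  p_e r s t =
    ((sh r * sh t * ch s - ch r * ch t) ^+ 2 - 1) / (sh r * sh s * sh t).
Proof.
move=> r0 s0 t0 R0 S0 T0; rewrite /p_e.
have -> : 8 * (-1 + r) * r * (1 + r) * (-1 + s) * s * (1 + s) * (-1 + t) * t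
    * (1 + t) = (8 * r * s * t) ^+ 2 * (sh r * sh s * sh t).
  transitivity (8 * r * s * t * ((r ^+ 2 - 1) * (s ^+ 2 - 1) * (t ^+ 2 - 1))).
    by ring.
  by rewrite !shE //; ring.
by rewrite u_prodE //; field; rewrite r0 s0 t0 R0 S0 T0.
Qed.

Definition quartics (r t : rat) : rat :=
  (1 + r - 2 * r ^+ 2 * t - t ^+ 2 + r * t ^+ 2)
  * (- 1 + r + 2 * r ^+ 2 * t + t ^+ 2 + r * t ^+ 2)
  * (- r - r ^+ 2 - 2 * t - r * t ^+ 2 + r ^+ 2 * t ^+ 2)
  * (r - r ^+ 2 - 2 * t + r * t ^+ 2 + r ^+ 2 * t ^+ 2).

(** On [s = s_of r t] each numerator factor [u_i], once cleared of denominators,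
    becomes one of the four quartics up to a factor [2] or [2 * r]. Together with
    [u_prodE], this says that [r, t] lifts to a rational point of the surface
    exactly when [a * e] is a square. *)
Lemma quarticsE (r s t : rat) : r != 0 -> s != 0 -> t != 0 ->
  s_den r t != 0 -> s = s_of r t ->
  quartics r t = (2 * s * t * s_den r t ^+ 2) ^+ 2
     * ((sh r * sh t * ch s - ch r * ch t) ^+ 2 - 1).
Proof.
move=> r0 s0 t0 d0 es.
have E1 : u1 r s t * s_den r t =
  -2 * (- r - r ^+ 2 - 2 * t - r * t ^+ 2 + r ^+ 2 * t ^+ 2).
  by rewrite es /u1 /s_of /s_num; move: d0; rewrite /s_den => d0; field.
have E2 : u2 r s t * s_den r t =
  - 2 * r * (1 + r - 2 * r ^+ 2 * t - t ^+ 2 + r * t ^+ 2).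
  by rewrite es /u2 /s_of /s_num; move: d0; rewrite /s_den => d0; field.
have E3 : u3 r s t * s_den r t =
  2 * (r - r ^+ 2 - 2 * t + r * t ^+ 2 + r ^+ 2 * t ^+ 2).
  by rewrite es /u3 /s_of /s_num; move: d0; rewrite /s_den => d0; field.
have E4 : u4 r s t * s_den r t =
  2 * r * (- 1 + r + 2 * r ^+ 2 * t + t ^+ 2 + r * t ^+ 2).
  by rewrite es /u4 /s_of /s_num; move: d0; rewrite /s_den => d0; field.
have n0 : (4 * r) ^+ 2 != 0 by rewrite expf_neq0 // mulf_neq0.
apply: (mulfI n0).
transitivity ((u1 r s t * s_den r t) * (u2 r s t * s_den r t)
   * (u3 r s t * s_den r t) * (u4 r s t * s_den r t)).
  by rewrite E1 E2 E3 E4 /quartics; ring.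
transitivity ((u1 r s t * u2 r s t * u3 r s t * u4 r s t) * s_den r t ^+ 4).
  by ring.
by rewrite u_prodE //; ring.
Qed.

(** If [s_den r t] vanished then so would [s_num r t], but the sum of their
    squares is positive. *)
Lemma s_den_neq0 (r s t : rat) : s * s_den r t = s_num r t -> s_den r t != 0.
Proof.
move=> h; apply/eqP => d0; move: h; rewrite d0 mulr0 => /esym n0.
have: s_num r t ^+ 2 + s_den r t ^+ 2 = 2 * (t ^+ 2 + 1) * ((r ^+ 2) ^+ 2 + 1).
  by rewrite /s_num /s_den; ring.
rewrite n0 d0 expr0n addr0 => /esym/eqP.
by rewrite !mulf_eq0 !(negPf (sqr1_neq0 _)).
Qed.

(** With [A = s * t - 1] and [B = s + t], one has
    [A ^+ 2 + B ^+ 2 = (s ^+ 2 + 1) * (t ^+ 2 + 1)], so the left-hand side is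
    proportional to
    [2 * (r ^+ 4 + 1) * A * B - (r ^+ 4 - 1) * (A ^+ 2 + B ^+ 2)], which splits as
    [((r ^+ 2 - 1) * A - (r ^+ 2 + 1) * B) * ((r ^+ 2 - 1) * B - (r ^+ 2 + 1) * A)].
    The first factor is [s * s_den r t - s_num r t]; the substitution
    [(r, s) |-> (- r^-1, - s^-1)] exchanges it with the second one, up to a
    nonzero scalar. *)
Lemma coupling_factor (r s t : rat) : r != 0 -> s != 0 -> t != 0 ->
  (sh t + sh s) * (1 + 2 * sh r ^+ 2) - 2 * sh r * (ch r * ch s * ch t) =
  (s * s_den r t - s_num r t)
  * (- s^-1 * s_den (- r^-1) t - s_num (- r^-1) t) / (8 * t).
Proof.
by move=> r0 s0 t0; rewrite /s_den /s_num /sh /ch; field; rewrite r0 s0 t0.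
Qed.

(** * Regular quadruples *)

(** Regularity is a quadratic equation in [e], with discriminant
    [16 * (a * b + 1) * (a * d + 1) * (b * d + 1)]. For the present [a], [b], [d]
    that is the square of [4 * u * v * w / S], and [a * e + 1] takes the two values
    below at the two roots. *)
Lemma regular_iff_extension (R S T u v w a b d e : rat) :
  R != 0 -> S != 0 -> T != 0 ->
  u ^+ 2 = R ^+ 2 + 1 -> v ^+ 2 = S ^+ 2 + 1 -> w ^+ 2 = T ^+ 2 + 1 ->
  a = R * S * T -> b = T / (R * S) -> d = R / (S * T) ->
  regular a b d e <->
  (a * e + 1 - (R * T * v - u * w) ^+ 2) * (a * e + 1 - (R * T * v + u * w) ^+ 2)
    = 0.
Proof.
move=> R0 S0 T0 hu hv hw ea eb ed.
(* The product is even in each of u, v and w, so the three relations apply. *)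
have -> : (a * e + 1 - (R * T * v - u * w) ^+ 2)
    * (a * e + 1 - (R * T * v + u * w) ^+ 2) =
    a ^+ 2 * ((a + b - d - e) ^+ 2 - 4 * (a * b + 1) * (d * e + 1)).
  transitivity ((a * e + 1 - R ^+ 2 * T ^+ 2 * v ^+ 2 - u ^+ 2 * w ^+ 2) ^+ 2
     - 4 * R ^+ 2 * T ^+ 2 * u ^+ 2 * v ^+ 2 * w ^+ 2); first by ring.
  by rewrite hu hv hw ea eb ed; field; rewrite R0 S0 T0.
have a0 : a ^+ 2 != 0 by rewrite ea expf_neq0 // !mulf_neq0.
rewrite /regular; split=> [->|/eqP]; first by rewrite subrr mulr0.
by rewrite mulf_eq0 (negPf a0) /= subr_eq0 => /eqP.
Qed.

Lemma regularAC (a b c d : rat) : regular a b c d -> regular a c b d.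
Proof.
rewrite /regular => h; apply/subr0_eq.
transitivity ((a + b - c - d) ^+ 2 - 4 * (a * b + 1) * (c * d + 1)).
  by ring.
by rewrite h subrr.
Qed.

(** Once [a * b + 1] is a nonzero square, regularity exhibits [c * d + 1] as a
    quotient of squares. *)
Lemma regular_square (a b c d q : rat) : regular a b c d ->
  a * b + 1 = q ^+ 2 -> q != 0 -> is_square (c * d + 1).
Proof.
rewrite /regular => h hq q0; exists ((a + b - c - d) / (2 * q)).
by rewrite expr_div_n h hq; field.
Qed.

(** * Exotic quintuples in hyperbolic coordinates *)

Lemma all_pairs5 (P : rat -> rat -> Prop) (a b c d e : rat) :
  (forall x y, P x y -> P y x) ->
  P a b -> P a c -> P a d -> P a e -> P b c -> P b d -> P b e -> P c d ->
  P c e -> P d e ->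
  {in [:: a; b; c; d; e] &, forall x y, x != y -> P x y}.
Proof.
move=> sym *; move=> x y; rewrite !inE.
by move=> /or4P [|||/orP[]] /eqP-> /or4P [|||/orP[]] /eqP->; rewrite ?eqxx // => _;
  try assumption; apply: sym.
Qed.

(** The two squares are the values of [a * e + 1] prescribed by the regularity of
    [{a, b, d, e}] and of [{a, c, d, e}]. As [b != c] forces [T != S], the two
    values agree exactly when the last factor is zero. *)
Lemma extension_sqr_diff (R S T u v w : rat) : u ^+ 2 = R ^+ 2 + 1 ->
  v ^+ 2 = S ^+ 2 + 1 -> w ^+ 2 = T ^+ 2 + 1 ->
  (R * T * v - u * w) ^+ 2 - (R * S * w - u * v) ^+ 2 =
  (T - S) * ((T + S) * (1 + 2 * R ^+ 2) - 2 * R * (u * v * w)).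
Proof.
move=> hu hv hw.
transitivity (R ^+ 2 * T ^+ 2 * v ^+ 2 + u ^+ 2 * w ^+ 2
   - R ^+ 2 * S ^+ 2 * w ^+ 2 - u ^+ 2 * v ^+ 2 - 2 * R * (T - S) * (u * v * w)).
  by ring.
by rewrite hu hv hw; ring.
Qed.

(** The products not involving [e] are the squares of [sh] of a parameter or of
    its inverse, so their successors are squares by [ch_sqr]. Modulo squares the
    products with [e] are all [a * e], and their successors are squares by
    regularity ([regular_square]); [a * e + 1] is one by construction. *)
Lemma hyperbolic_is_exotic (r s t a b c d e : rat) :
  r != 0 -> s != 0 -> t != 0 -> sh r != 0 -> sh s != 0 -> sh t != 0 ->
  a = sh r * sh s * sh t -> b = sh t / (sh r * sh s) ->
  c = sh s / (sh r * sh t) -> d = sh r / (sh s * sh t) ->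
  a * e = (sh r * sh t * ch s - ch r * ch t) ^+ 2 - 1 ->
  (sh t + sh s) * (1 + 2 * sh r ^+ 2) = 2 * sh r * (ch r * ch s * ch t) ->
  is_square (a * e) ->
  uniq [:: a; b; c; d; e] -> 0 \notin [:: a; b; c; d; e] ->
  exotic a b c d e.
Proof.
move=> r0 s0 t0 R0 S0 T0 ea eb ec ed eX rel [q hq] Hu Hn.
have a0 : a != 0 by rewrite ea mul3_neq0.
have hr := ch_sqr _ r0; have hs := ch_sqr _ s0; have ht := ch_sqr _ t0.
have r1 := ch_neq0 _ r0; have s1 := ch_neq0 _ s0; have t1 := ch_neq0 _ t0.
have X2 : a * e + 1 = (sh r * sh t * ch s - ch r * ch t) ^+ 2.
  by rewrite eX subrK.
have reg1 : regular a b d e.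
  by apply/(regular_iff_extension _ _ _ _ _ _ _ _ _ _ R0 S0 T0 hr hs ht ea eb ed);
    rewrite X2 subrr mul0r.
have reg2 : regular a c d e.
  have ea' : a = sh r * sh t * sh s by rewrite ea; ring.
  have ed' : d = sh r / (sh t * sh s) by rewrite ed; congr (_ / _); ring.
  apply/(regular_iff_extension _ _ _ _ _ _ _ _ _ _ R0 T0 S0 hr ht hs ea' ec ed').
  by rewrite X2 (extension_sqr_diff _ _ _ _ _ _ hr hs ht) rel subrr mulr0 mul0r.
have ab : a * b = sh t ^+ 2 by rewrite ea eb; field; rewrite R0 S0.
have ac : a * c = sh s ^+ 2 by rewrite ea ec; field; rewrite R0 T0.
have ad : a * d = sh r ^+ 2 by rewrite ea ed; field; rewrite S0 T0.
have bc : b * c = (sh r)^-1 ^+ 2 by rewrite eb ec; field; rewrite S0 T0 R0.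
have bd : b * d = (sh s)^-1 ^+ 2 by rewrite eb ed; field; rewrite S0 T0 R0.
have cd : c * d = (sh t)^-1 ^+ 2 by rewrite ec ed; field; rewrite S0 T0 R0.
have inv1 x : x != 0 -> sh x != 0 -> (sh x)^-1 ^+ 2 + 1 = (ch x / sh x) ^+ 2.
  by move=> x0 X0; rewrite expr_div_n ch_sqr //; field.
have xe x k : a * x = k ^+ 2 -> is_square (x * e).
  move=> hk; exists (k * q / a); rewrite expr_div_n exprMn -hk -hq.
  by field.
split=> //; last first.
- apply: all_pairs5; [by move=> x y; rewrite mulrC | | | | by exists q | | | | | |];
    first [by eexists; eassumption | by apply: xe; eassumption].
- by rewrite ea eb ec ed; field; rewrite R0 S0 T0.
split=> //; apply: all_pairs5.
- by move=> x y; rewrite mulrC.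
- by exists (ch t); rewrite ab ht.
- by exists (ch s); rewrite ac hs.
- by exists (ch r); rewrite ad hr.
- by rewrite X2; eexists.
- by rewrite bc inv1 //; eexists.
- by rewrite bd inv1 //; eexists.
- by apply: regular_square (regularAC _ _ _ _ reg1) _ r1; rewrite ad hr.
- by rewrite cd inv1 //; eexists.
- by apply: regular_square (regularAC _ _ _ _ reg2) _ r1; rewrite ad hr.
- by apply: regular_square reg1 _ t1; rewrite ab ht.
Qed.

(** Up to signs, [sh t], [sh s], [sh r] are the square roots of [a * b], [a * c],
    [a * d]. The signs of [R], [S], [u] are adjusted so that [a = R * S * T]
    and so that [e] is, in both regular quadruples, the root with the minus
    sign. *)
Lemma exotic_has_hyperbolic (a b c d e : rat) : exotic a b c d e ->
  exists r s t, [/\ [/\ r != 0, s != 0 & t != 0],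
    [/\ sh r != 0, sh s != 0 & sh t != 0],
    [/\ a = sh r * sh s * sh t, b = sh t / (sh r * sh s),
      c = sh s / (sh r * sh t) & d = sh r / (sh s * sh t)],
    a * e = (sh r * sh t * ch s - ch r * ch t) ^+ 2 - 1 &
    (sh t + sh s) * (1 + 2 * sh r ^+ 2) = 2 * sh r * (ch r * ch s * ch t)].
Proof.
case=> [[Hu Hn Hp] abcd reg1 reg2 Hs].
move: (Hu); rewrite /= !inE !negb_or.
case/and5P=> /and4P [nab nac nad nae] /and3P [nbc nbd nbe] /andP[ncd nce] nde _.
have [T hT] : is_square (a * b) by apply: Hs => //; rewrite !inE eqxx ?orbT.
have [S hS] : is_square (a * c) by apply: Hs => //; rewrite !inE eqxx ?orbT.
have [R hR] : is_square (a * d) by apply: Hs => //; rewrite !inE eqxx ?orbT.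
have [w hw] : is_square (a * b + 1) by apply: Hp => //; rewrite !inE eqxx ?orbT.
have [v hv] : is_square (a * c + 1) by apply: Hp => //; rewrite !inE eqxx ?orbT.
have [u hu] : is_square (a * d + 1) by apply: Hp => //; rewrite !inE eqxx ?orbT.
rewrite hT in hw; rewrite hS in hv; rewrite hR in hu.
move: Hn; rewrite !inE !negb_or !(eq_sym 0) => /and5P [a0 b0 c0 d0 e0].
have T0 : T != 0 by rewrite -sqrf_eq0 -hT mulf_neq0.
have S0 : S != 0 by rewrite -sqrf_eq0 -hS mulf_neq0.
have R0 : R != 0 by rewrite -sqrf_eq0 -hR mulf_neq0.
wlog ea : R R0 hR hu / a = R * S * T.
  have : a ^+ 2 = (R * S * T) ^+ 2.
    by rewrite !exprMn -hT -hS -hR -[LHS]mulr1 -abcd; ring.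
  move/eqP; rewrite eqf_sqr => /orP[] /eqP ea wl; first exact: (wl R).
  by apply: (wl (- R)); rewrite ?oppr_eq0 ?sqrrN // ea; ring.
have eb : b = T / (R * S).
  by apply: (mulfI a0); rewrite hT ea; field; rewrite R0 S0.
have ec : c = S / (R * T).
  by apply: (mulfI a0); rewrite hS ea; field; rewrite R0 T0.
have ed : d = R / (S * T).
  by apply: (mulfI a0); rewrite hR ea; field; rewrite S0 T0.
wlog eX : u hu / a * e + 1 = (R * T * v - u * w) ^+ 2.
  have /eqP := proj1 (regular_iff_extension _ _ _ _ _ _ _ _ _ e R0 S0 T0 (esym hu)
    (esym hv) (esym hw) ea eb ed) reg1.
  rewrite mulf_eq0 !subr_eq0 => /orP[] /eqP eX wl; first exact: (wl u).
  by apply: (wl (- u)); rewrite ?sqrrN // eX mulNr opprK.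
(* Negating R, S and u together preserves a, b, c, d and, up to sign, the
   quantity R * T * v - u * w, but flips u * v relatively to R * S * w. *)
wlog eY : R u S R0 S0 hR hS hu hv ea eb ec ed eX /
    a * e + 1 = (R * S * w - u * v) ^+ 2.
  have ea' : a = R * T * S by rewrite ea; ring.
  have ed' : d = R / (T * S) by rewrite ed; congr (_ / _); ring.
  have /eqP := proj1 (regular_iff_extension _ _ _ _ _ _ _ _ _ e R0 T0 S0 (esym hu)
    (esym hw) (esym hv) ea' ec ed') reg2.
  rewrite mulf_eq0 !subr_eq0 => /orP[] /eqP eY wl; first exact: (wl R u S).
  apply: (wl (- R) (- u) (- S)); rewrite ?oppr_eq0 ?sqrrN ?mulrNN //.
  - by rewrite ec !mulNr invrN mulrN opprK.
  - by rewrite ed !mulNr invrN mulrN opprK.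
  - by rewrite eX !mulNr; ring.
  - by rewrite eY; ring.
have rel : (T + S) * (1 + 2 * R ^+ 2) = 2 * R * (u * v * w).
  have TS : T - S != 0.
    apply: contraNneq nbc => /subr0_eq TS.
    by rewrite eb ec TS.
  apply/eqP; rewrite -subr_eq0; apply/eqP/(mulfI TS).
  rewrite mulr0 -(extension_sqr_diff _ _ _ _ _ _ (esym hu) (esym hv) (esym hw)).
  by rewrite -eX -eY subrr.
have [r [r0 rR ru]] := hyperbola_param _ _ (esym hu).
have [s [s0 sS sv]] := hyperbola_param _ _ (esym hv).
have [t [t0 tT tw]] := hyperbola_param _ _ (esym hw).
exists r, s, t; rewrite rR ru sS sv tT tw; split=> //.
by rewrite -eX addrK.
Qed.

Lemma hyperbolic_is_p (r s t a b c d e : rat) :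
  r != 0 -> s != 0 -> t != 0 -> sh r != 0 -> sh s != 0 -> sh t != 0 ->
  a = sh r * sh s * sh t -> b = sh t / (sh r * sh s) ->
  c = sh s / (sh r * sh t) -> d = sh r / (sh s * sh t) ->
  a * e = (sh r * sh t * ch s - ch r * ch t) ^+ 2 - 1 ->
  is_square (a * e) -> s * s_den r t = s_num r t ->
  exists y, dom_p r t y /\ p r t y = (a, b, c, d, e).
Proof.
move=> r0 s0 t0 R0 S0 T0 ea eb ec ed eX [q hq] es.
have D0 := s_den_neq0 _ _ _ es.
have sE : s = s_of r t by rewrite /s_of -es mulfK.
have q1 x : x != 0 -> sh x != 0 -> x ^+ 2 - 1 != 0.
  by move=> x0 X0; rewrite shE // mul3_neq0.
exists (2 * s * t * s_den r t ^+ 2 * q); split; last first.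
  rewrite /p -sE p_aE // p_bE // p_cE // p_dE // p_eE // -ea -eb -ec -ed.
  by rewrite -eX mulrAC divff ?mul1r // ea mul3_neq0.
rewrite /dom_p -sE; split=> //.
- rewrite /on_S exprMn -hq eX -quarticsE //.
- by split; rewrite !mulf_neq0 ?q1.
have -> : 8 * (-1 + r) * r * (1 + r) * (-1 + s) * s * (1 + s) * (-1 + t) * t
    * (1 + t) = 8 * r * s * t * ((r ^+ 2 - 1) * (s ^+ 2 - 1) * (t ^+ 2 - 1)).
  by ring.
by rewrite !mulf_neq0 ?q1.
Qed.

Theorem proposition2 :
  (forall a b c d e : rat, exotic a b c d e ->
     exists r t y : rat, dom_p r t y /\ p r t y = (a, b, c, d, e))
  /\
  (forall r t y a b c d e : rat,
     dom_p r t y -> p r t y = (a, b, c, d, e) ->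
     uniq [:: a; b; c; d; e] -> 0 \notin [:: a; b; c; d; e] ->
     exotic a b c d e).
Proof.
split=> [a b c d e ex|r t y a b c d e].
  have sq : is_square (a * e).
    case: (ex) => [[Hu _ _] _ _ _]; apply; rewrite ?inE ?eqxx ?orbT //.
    by move: Hu; rewrite /= !inE !negb_or => /andP[/and4P[]].
  have [r [s [t [[r0 s0 t0] [R0 S0 T0] [ea eb ec ed] eX rel]]]] :=
    exotic_has_hyperbolic _ _ _ _ _ ex.
  have := coupling_factor r s t r0 s0 t0; rewrite rel subrr => /esym/eqP.
  rewrite !mulf_eq0 invr_eq0 (negPf (mulf_neq0 _ t0)) // orbF !subr_eq0.
  case/orP=> /eqP h.
    by exists r, t; apply: (hyperbolic_is_p r s t).
  (* When the second factor vanishes, change the signs of ch r and ch s. *)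
  exists (- r^-1), t; apply: (hyperbolic_is_p (- r^-1) (- s^-1) t);
    rewrite ?sh_negV ?ch_negV ?oppr_eq0 ?invr_eq0 //.
  by rewrite eX; ring.
move=> [onS D0 [n1 n2 n3 _] _]; set s := s_of r t in n1 n2 n3 *.
have {n1} [r0 s0 t0] : [/\ r != 0, s != 0 & t != 0].
  by move: n1; rewrite !mulf_eq0 !negb_or => /andP[/andP[/andP[_ ->] ->] ->].
have {n2 n3} [R0 S0 T0] : [/\ sh r != 0, sh s != 0 & sh t != 0].
  move: n2 n3; rewrite !shE // !mulf_eq0 !negb_or.
  by move=> /andP[/andP[/andP[_ ->] /andP[_ ->]] _] /andP[/andP[_ /andP[_ ->]] _].
rewrite /p -/s p_aE // p_bE // p_cE // p_dE // p_eE // => -[ea eb ec ed ee].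
have a0 : a != 0 by rewrite -ea mul3_neq0.
have eX : a * e = (sh r * sh t * ch s - ch r * ch t) ^+ 2 - 1.
  by rewrite -ee ea mulrC divfK.
apply: (hyperbolic_is_exotic r s t) => //.
  apply/eqP; rewrite -subr_eq0 coupling_factor //.
  by rewrite /s /s_of divfK // subrr !mul0r.
have k0 : 2 * s * t * s_den r t ^+ 2 != 0 by rewrite mulf_neq0 ?expf_neq0 // mul3_neq0.
exists (y / (2 * s * t * s_den r t ^+ 2)).
by rewrite expr_div_n -onS -/(quartics r t) (quarticsE r s t) // -eX mulrAC divff ?mul1r // expf_neq0.
Qed.
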